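(* Let $\mathcal{A}$ be a (not necessarily associative) algebra over a field $\mathbb{F}$ which is a module of finite length for its multiplication algebra $M(\mathcal{A})$ (this is always the case if $\mathcal{A}$ is finite-dimensional). Then $\mathcal{A}$ decomposes as a finite direct sum of indecomposable ideals. Moreover, if $$\mathcal{A} = \mathcal{I}_1 \oplus \cdots \oplus \mathcal{I}_n = \mathcal{J}_1 \oplus \cdots \oplus \mathcal{J}_m$$ with $\mathcal{I}_i$, $\mathcal{J}_j$ indecomposable ideals for all $i=1,\ldots,n$ and $j=1,\ldots,m$, then $n=m$ and there is a permutation $\sigma\in S_n$ such that $\mathcal{I}_i$ is isomorphic (as an algebra) to $\mathcal{J}_{\sigma(i)}$ for all $i=1,\ldots,n$.
   Context: Algebras are vector spaces over a field $\mathbb{F}$ with a bilinear product; associativity is not assumed. For $x\in\mathcal{A}$ let $L_x: y\mapsto xy$ and $R_x: y\mapsto yx$. The multiplication algebra $M(\mathcal{A})$ is the subalgebra of $\mathrm{End}_{\mathbb{F}}(\mathcal{A})$ generated by all $L_x, R_x$, $x\in\mathcal{A}$. $\mathcal{A}$ is a left module for the associative algebra $M(\mathcal{A})$, and the ideals of $\mathcal{A}$ are precisely the submodules of $\mathcal{A}$ as an $M(\mathcal{A})$-module. An algebra $\mathcal{A}$ is said to be indecomposable (resp. decomposable) if it is so as an $M(\mathcal{A})$-module. That is, $\mathcal{A}$ is decomposable if there are nonzero ideals $\mathcal{I}$ and $\mathcal{J}$ such that $\mathcal{A}=\mathcal{I}\oplus\mathcal{J}$; otherwise, it is indecomposable.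 An ideal of $\mathcal{A}$ is called indecomposable in the same sense, as an $M(\mathcal{A})$-module. *)

(* Defs.v *)
From HB Require Import structures.
From mathcomp Require Import all_boot all_order all_algebra all_fingroup.
From mathcomp Require Import boolp classical_sets functions.

Set Implicit Arguments.
Unset Strict Implicit.
Unset Printing Implicit Defensive.

Import GRing.Theory.
Local Open Scope classical_set_scope.
Local Open Scope ring_scope.

Section Modules.
Context {F : fieldType} {V : lmodType F}.
Implicit Types (M : set (V -> V)) (N : set V).

Definition finite_dimensional : Prop := exists n, inhabited (Vector.axiom n V).

(* Unital associative subalgebras of End_F(V).  As V -> V also contains
   nonlinear maps, linearity is required explicitly. *)
Definition subalgebra_End M : Prop :=
  [/\ forall f, M f -> linear f,
      M idfun,
      forall (a : F) f g, M f -> M g -> M (fun y => a *: f y + g y)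
    & forall f g, M f -> M g -> M (f \o g)].

(* Below, V is seen as a left module for an algebra M of endomorphisms. *)
Definition submodule M N : Prop :=
  submod_closed [in N] /\ forall f, M f -> f @` N `<=` N.

(* A composition series 0 = c 0 < c 1 < ... < c l = V; simplicity of the
   quotient c i.+1 / c i is expressed by the correspondence theorem. *)
Definition finite_length M : Prop :=
  exists (l : nat) (c : nat -> set V),
    [/\ c 0%N = [set 0], c l = [set: V],
        forall i, (i <= l)%N -> submodule M (c i)
      & forall i, (i < l)%N ->
          c i `<` c i.+1 /\
          forall N, submodule M N -> c i `<=` N -> N `<=` c i.+1 ->
            N = c i \/ N = c i.+1].

Definition decomposable M N : Prop :=
  exists J K : set V,
    [/\ submodule M J /\ submodule M K,
        J <> [set 0] /\ K <> [set 0],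
        N = [set x + y | x in J & y in K]
      & J `&` K = [set 0]].

(* The zero module is not indecomposable: otherwise zero summands could be
   added freely and the number of summands would not be unique. *)
Definition indecomposable M N : Prop :=
  [/\ submodule M N, N <> [set 0] & ~ decomposable M N].

(* V is the internal direct sum of the I i; n = 0 is allowed, and then V = 0. *)
Definition direct_sum n (I : 'I_n -> set V) : Prop :=
  forall x : V, exists! v : {ffun 'I_n -> V},
    (forall i, I i (v i)) /\ x = \sum_(i < n) v i.

End Modules.

Arguments finite_dimensional {F} V.

Section Algebras.
Context {F : fieldType} {A : lmodType F}.
Context (mul : {bilinear A -> A -> A}).
Implicit Types I J : set A.

Definition mult_algebra : set (A -> A) :=
  smallest subalgebra_End
    [set f | exists x : A, f = mul x \/ f = mul^~ x].

Definition ideal I : Prop :=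
  submod_closed [in I] /\ forall x y, I y -> I (mul x y) /\ I (mul y x).

(* Isomorphism of I and J as algebras with the restricted products; the values
   of f outside I are irrelevant. *)
Definition alg_isomorphic I J : Prop :=
  exists f : A -> A,
    [/\ set_bij I J f,
        forall (a : F) x y, I x -> I y -> f (a *: x + y) = a *: f x + f y
      & forall x y, I x -> I y -> f (mul x y) = mul (f x) (f y)].

End Algebras.

(* Main.v *)
Require Import Defs.
From mathcomp Require Import all_boot all_order all_algebra all_fingroup.
From mathcomp Require Import boolp classical_sets functions.
From mathcomp Require Import zify.

Set Implicit Arguments.
Unset Strict Implicit.
Unset Printing Implicit Defensive.

Import GRing.Theory.
Local Open Scope ring_scope.

(* A composition series yields a strictly monotone length on submodules, whence
   Fitting's lemma and the fact that an isomorphism of an indecomposable module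
   which is a sum of endomorphisms has an isomorphism among its summands.  With
   [pi j] the projections onto the [J j], this is applied to the identity of
   [I k], written as the sum over [j] of [p \o pi j], where [p] projects onto
   [I k] along the summands obtained so far by replacing some of the [I i] by
   some of the [J j].  As [p] kills the [J j] already used, a new [j] occurs,
   [pi j : I k -> J j] is bijective, and [I k] can be replaced by [J j].
   Contrary to an arbitrary module isomorphism, the projection [pi j] onto an
   ideal summand is also multiplicative. *)

(** The well-ordering of the naturals, transported along [mu]. It selects a smallest submodule above
    a given one, the exponent in Fitting's lemma, and a matrix of maximal rank. *)
Lemma exists_argmin T (P : T -> Prop) (mu : T -> nat) :
  (exists t, P t) -> exists2 t, P t & forall u, P u -> (mu t <= mu u)%N.
Proof.
move=> exP; pose Q n := `[< exists2 t, P t & mu t = n >].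
have exQ : exists n, Q n by case: exP => t Pt; exists (mu t); apply/asboolP; exists t.
case: (ex_minnP exQ) => n /asboolP[t Pt <-] nmin; exists t => // u Pu.
by apply: nmin; apply/asboolP; exists u.
Qed.

(** * Submodules for a set of linear maps *)

Section Submodules.
Local Open Scope classical_set_scope.
Context {F : fieldType} {V : lmodType F}.
Variable M : set (V -> V).
Implicit Types N J K : set V.

Lemma submoduleP N : submodule M N <->
  [/\ N 0, forall (a : F) x y, N x -> N y -> N (a *: x + y)
    & forall f x, M f -> N x -> N (f x)].
Proof.
split=> [[[N0 NL] NM]|[N0 NL NM]]; split.
- by rewrite inE in N0.
- by move=> a x y Nx Ny; have := NL a x y; rewrite !inE; apply.
- by move=> f x Mf Nx; apply: (NM f Mf); exists x.
- split; first by rewrite inE.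
  by move=> a x y; rewrite !inE; apply: NL.
- by move=> f Mf _ [x Nx <-]; apply: NM.
Qed.

Section Closure.
Variables (N : set V) (subN : submodule M N).

Lemma submodule0 : N 0. Proof. by case/submoduleP: subN. Qed.

Lemma submoduleZD (a : F) x y : N x -> N y -> N (a *: x + y).
Proof. by case/submoduleP: subN => _ + _; apply. Qed.

Lemma submoduleD x y : N x -> N y -> N (x + y).
Proof. by move=> Nx Ny; rewrite -[x]scale1r; apply: submoduleZD. Qed.

Lemma submoduleN x : N x -> N (- x).
Proof.
by move=> Nx; rewrite -scaleN1r -[_ *: _]addr0; apply: submoduleZD => //; exact: submodule0.
Qed.

Lemma submoduleB x y : N x -> N y -> N (x - y).
Proof. by move=> Nx Ny; apply: submoduleD => //; apply: submoduleN. Qed.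

Lemma submodule_act f x : M f -> N x -> N (f x).
Proof. by case/submoduleP: subN => _ _; apply. Qed.

Lemma submodule_sum (I : Type) (r : seq I) (P : pred I) (v : I -> V) :
  (forall i, P i -> N (v i)) -> N (\sum_(i <- r | P i) v i).
Proof. by move=> Nv; elim/big_ind: _ => //; [apply: submodule0|apply: submoduleD]. Qed.

End Closure.

Lemma submoduleT : submodule M [set: V].
Proof. exact/submoduleP. Qed.

Lemma submoduleI J K : submodule M J -> submodule M K -> submodule M (J `&` K).
Proof.
move=> sJ sK; apply/submoduleP; split.
- by split; apply: submodule0.
- by move=> a x y [? ?] [? ?]; split; apply: submoduleZD.
- by move=> f x Mf [? ?]; split; [apply: (submodule_act sJ)|apply: (submodule_act sK)].
Qed.

Hypothesis M_linear : forall f, M f -> linear f.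

Lemma actZD f (a : F) x y : M f -> f (a *: x + y) = a *: f x + f y.
Proof. by move/M_linear; apply. Qed.

Lemma act0 f : M f -> f 0 = 0.
Proof.
by move=> Mf; have := actZD 1 0 0 Mf; rewrite !scale1r addr0 => /esym/eqP; rewrite -subr_eq0 addrK => /eqP.
Qed.

Lemma actD f x y : M f -> f (x + y) = f x + f y.
Proof. by move=> Mf; have := actZD 1 x y Mf; rewrite !scale1r. Qed.

Lemma act_sum f (I : Type) (r : seq I) (v : I -> V) : M f ->
  f (\sum_(i <- r) v i) = \sum_(i <- r) f (v i).
Proof.
move=> Mf; elim: r => [|i r IHr]; first by rewrite !big_nil act0.
by rewrite !big_cons actD // IHr.
Qed.

Lemma submodule_zero : submodule M [set 0].
Proof.
apply/submoduleP; split=> [//|a x y -> ->|f x Mf ->] /=.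
- by rewrite scaler0 addr0.
- exact: act0.
Qed.

Lemma submodule_add J K : submodule M J -> submodule M K ->
  submodule M [set x + y | x in J & y in K].
Proof.
move=> sJ sK; apply/submoduleP; split.
- by exists 0; [apply: submodule0|exists 0; [apply: submodule0|rewrite addr0]].
- move=> a _ _ [x Jx [y Ky <-]] [x' Jx' [y' Ky' <-]].
  exists (a *: x + x'); first exact: submoduleZD.
  exists (a *: y + y'); first exact: submoduleZD.
  by rewrite scalerDr addrACA.
- move=> f _ Mf [x Jx [y Ky <-]].
  exists (f x); first exact: (submodule_act sJ).
  exists (f y); first exact: (submodule_act sK).
  by rewrite actD.
Qed.

Lemma submodule_neq0 N : submodule M N -> N <> [set 0] -> exists2 x, N x & x <> 0.
Proof.
move=> sN N0; apply: contrapT => no; apply: N0; apply/seteqP; split=> [x Nx|_ ->] /=.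
- by apply: contrapT => x0; apply: no; exists x.
- exact: submodule0.
Qed.

(** * Lengths *)

(** Abstracts the two properties of the composition length that the proof uses, so that ranks of
    matrices can serve as lengths too. *)
Definition strict_length (len : set V -> nat) : Prop :=
  forall N N', submodule M N -> submodule M N' -> N `<=` N' ->
    (len N <= len N')%N /\ (len N = len N' -> N = N').

(** The length of [N] is the number of indices [i] at which [N] meets [c i.+1] outside [c i], that
    is, of nonzero factors of the series that [N] induces. *)
Lemma finite_length_strict_length :
  finite_length M -> exists len, strict_length len.
Proof.
case=> l [c [c0 cl sc simple_c]].
pose jump N i := `[< exists2 x, N x & c i.+1 x /\ ~ c i x >].
exists (fun N => \sum_(i < l) jump N i)%N => N N' sN sN' NN'.
have jump_le i : (jump N i <= jump N' i)%N.
  rewrite /jump; case: asboolP => // -[x Nx cx]; case: asboolP => // -[].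
  by exists x; [apply: NN'|].
split=> [|eq_len]; first by apply: leq_sum => i _.
(* The jumps of [N] are termwise at most those of [N'], so equal sums leave no index at which only
   [N'] jumps. *)
have eq_jump i : (i < l)%N -> jump N' i -> jump N i.
  move=> li; have := eq_len; rewrite (bigD1 (Ordinal li)) //=.
  rewrite [RHS](bigD1 (Ordinal li)) //=.
  have : (\sum_(j < l | j != Ordinal li) jump N j <=
          \sum_(j < l | j != Ordinal li) jump N' j)%N by apply: leq_sum => j _.
  case: (jump N i) => // le_sum /eqP + jN'; rewrite jN' add0n add1n => /eqP e.
  by move: le_sum; rewrite e ltnn.
have main i : (i <= l)%N -> N' `&` c i `<=` N.
  elim: i => [|i IHi] li x [N'x cx].
    by move: cx; rewrite c0 => ->; apply: submodule0.
  case: (pselect (c i x)) => cix; first by apply: IHi => //; exact: ltnW.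
  have /eq_jump -/(_ li) /asboolP[y Ny [cy ciy]] : jump N' i.
    by apply/asboolP; exists x.
  have [[ci_sub _] simple_i] := simple_c i li.
  have sci : submodule M (c i) by apply: sc; apply: ltnW.
  have sci1 : submodule M (c i.+1) by apply: sc.
  (* [S] contains [y], which is not in [c i], so simplicity of the factor gives [S = c i.+1]. Then
     [x = u + v] with [v] in [N], and [u = x - v] lies in [N'] and in [c i], hence in [N] by
     induction. *)
  pose S := [set u + v | u in c i & v in N `&` c i.+1].
  have sS : submodule M S by apply: submodule_add => //; apply: submoduleI.
  have ciS : c i `<=` S.
    move=> u cu; exists u => //; exists 0; last by rewrite addr0.
    by split; apply: submodule0.
  have Sci1 : S `<=` c i.+1.
    move=> _ [u cu [v [_ cv] <-]]; apply: submoduleD => //.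
    exact: ci_sub.
  have Sy : S y.
    by exists 0; [apply: submodule0|exists y => //; rewrite add0r].
  case: (simple_i S sS ciS Sci1) => eS; first by move: Sy; rewrite eS.
  move: cx; rewrite -eS => -[u cu [v [Nv cv] exv]].
  rewrite -exv; apply: submoduleD => //; apply: (IHi (ltnW li)); split=> //.
  by rewrite -(addrK v u) exv; apply: submoduleB => //; apply: NN'.
apply/seteqP; split=> // x N'x; apply: (main l) => //.
by rewrite cl.
Qed.

(** Starting from zero, one climbs repeatedly to a smallest strictly larger submodule. The length
    increases strictly and never exceeds that of the whole space, so the climb ends there. *)
Lemma bounded_strict_length_finite_length (len : set V -> nat) :
  strict_length len -> finite_length M.
Proof.
move=> lenP.
suff chain b N : submodule M N -> (len [set: V] - len N < b)%N ->
    exists (l : nat) (c : nat -> set V),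
    [/\ c 0%N = N, c l = [set: V],
        forall i, (i <= l)%N -> submodule M (c i)
      & forall i, (i < l)%N ->
          c i `<` c i.+1 /\
          forall N', submodule M N' -> c i `<=` N' -> N' `<=` c i.+1 ->
            N' = c i \/ N' = c i.+1].
  exact: (chain _ [set 0] submodule_zero (ltnSn _)).
elim: b N => // b IHb N sN lenN.
case: (pselect (N = [set: V])) => [->|NT].
  by exists 0%N, (fun _ => [set: V]); split=> // i _; exact: submoduleT.
(* A submodule between [N] and [N1] other than [N] is at least as long as [N1], so strictness makes
   it equal to [N1]: the factor is simple. *)
have [|N1 [sN1 NN1 neN1] minN1] := @exists_argmin _
    (fun K => [/\ submodule M K, N `<=` K & K <> N]) len.
  by exists [set: V]; split=> //; [exact: submoduleT|exact/nesym].
have len_lt : (len N < len N1)%N.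
  have [le e] := lenP _ _ sN sN1 NN1.
  by rewrite ltn_neqAle le andbT; apply/eqP => /e /esym.
have [le1 _] := lenP _ _ sN1 submoduleT (@subsetT _ N1).
have [|l [c [c0 cl sc simple_c]]] := IHb N1 sN1.
  apply: leq_trans (_ : len [set: V] - len N <= b)%N; last by [].
  by apply: ltn_sub2l => //; apply: leq_trans le1.
exists l.+1, (fun i => if i is j.+1 then c j else N); split=> //.
- by case.
- case=> [_|i]; last exact: simple_c.
  rewrite c0; split.
    by split=> // N1N; apply: neN1; apply/seteqP; split.
  move=> K sK NK KN1; case: (pselect (K = N)) => [->|KN]; [by left|right].
  have [le e] := lenP _ _ sK sN1 KN1.
  by apply: e; apply/eqP; rewrite eqn_leq le minN1.
Qed.

(** * Homomorphisms *)

(** Homomorphisms are total maps on [V] of which only the restriction to [N] matters; they are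
    compared pointwise on [N]. *)
Definition module_hom N N' (f : V -> V) : Prop :=
  [/\ forall x, N x -> N' (f x),
      forall (a : F) x y, N x -> N y -> f (a *: x + y) = a *: f x + f y
    & forall g x, M g -> N x -> f (g x) = g (f x)].

Definition module_isom N N' (f : V -> V) : Prop :=
  [/\ module_hom N N' f, forall x, N x -> f x = 0 -> x = 0
    & forall y, N' y -> exists2 x, N x & f x = y].

Section HomTheory.
Variables (N N' : set V) (f : V -> V).
Hypotheses (sN : submodule M N) (fP : module_hom N N' f).

Lemma module_homD x y : N x -> N y -> f (x + y) = f x + f y.
Proof. by case: fP => _ fL _ Nx Ny; have := fL 1 x y Nx Ny; rewrite !scale1r. Qed.

Lemma module_hom0 : f 0 = 0.
Proof.
have := module_homD (submodule0 sN) (submodule0 sN); rewrite addr0 => /esym/eqP.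
by rewrite -subr_eq0 addrK => /eqP.
Qed.

Lemma module_homN x : N x -> f (- x) = - f x.
Proof.
move=> Nx; apply/eqP; rewrite -addr_eq0 -module_homD //; last exact: submoduleN.
by rewrite addNr module_hom0.
Qed.

Lemma module_homB x y : N x -> N y -> f (x - y) = f x - f y.
Proof. by move=> Nx Ny; rewrite module_homD ?module_homN//; exact: submoduleN. Qed.

Lemma module_hom_sum (I : Type) (r : seq I) (v : I -> V) :
  (forall i, N (v i)) -> f (\sum_(i <- r) v i) = \sum_(i <- r) f (v i).
Proof.
move=> Nv; elim: r => [|i r IHr]; first by rewrite !big_nil module_hom0.
by rewrite !big_cons module_homD ?IHr//; apply: submodule_sum.
Qed.

Lemma submodule_ker : submodule M [set x | N x /\ f x = 0].
Proof.
case: (fP) => _ fL fM; apply/submoduleP; split.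
- by split; [apply: submodule0|apply: module_hom0].
- move=> a x y [Nx fx] [Ny fy]; split; first exact: submoduleZD.
  by rewrite fL// fx fy scaler0 addr0.
- move=> g x Mg [Nx fx]; split; first exact: (submodule_act sN).
  by rewrite fM// fx act0.
Qed.

Lemma submodule_image : submodule M (f @` N).
Proof.
case: (fP) => _ fL fM; apply/submoduleP; split.
- by exists 0; [apply: submodule0|apply: module_hom0].
- move=> a _ _ [x Nx <-] [y Ny <-]; exists (a *: x + y); first exact: submoduleZD.
  by rewrite fL.
- move=> g _ Mg [x Nx <-]; exists (g x); first exact: (submodule_act sN).
  by rewrite fM.
Qed.

End HomTheory.

Lemma module_hom_sub N1 N2 N f : N1 `<=` N2 -> module_hom N2 N f -> module_hom N1 N f.
Proof.
move=> sub [fN fL fM]; split=> [x /sub/fN //|a x y /sub Nx /sub Ny|g x Mg /sub Nx].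
- exact: fL.
- exact: fM.
Qed.

Lemma module_hom_comp N1 N2 N3 f g :
  module_hom N1 N2 f -> module_hom N2 N3 g -> module_hom N1 N3 (g \o f).
Proof.
move=> [fN fL fM] [gN gL gM]; split=> [x /fN/gN //|a x y Nx Ny|h x Mh Nx] /=.
- by rewrite fL// gL//; apply: fN.
- by rewrite fM// gM//; apply: fN.
Qed.

Lemma module_hom_add N N' f g : submodule M N' ->
  module_hom N N' f -> module_hom N N' g -> module_hom N N' (fun x => f x + g x).
Proof.
move=> sN' [fN fL fM] [gN gL gM]; split=> [x Nx|a x y Nx Ny|h x Mh Nx].
- by apply: submoduleD => //; [apply: fN|apply: gN].
- by rewrite fL// gL// scalerDr addrACA.
- by rewrite fM// gM// actD.
Qed.

Lemma module_hom_zero N N' : submodule M N' -> module_hom N N' (fun=> 0).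
Proof.
move=> sN'; split=> [x _|a x y _ _|g x Mg _].
- exact: submodule0.
- by rewrite scaler0 addr0.
- by rewrite act0.
Qed.

Lemma module_hom_big_sum N N' (I : Type) (r : seq I) (g : I -> V -> V) :
  submodule M N' -> (forall i, module_hom N N' (g i)) ->
  module_hom N N' (fun x => \sum_(i <- r) g i x).
Proof.
move=> sN' gP; elim: r => [|i r IHr].
  rewrite (_ : (fun _ => _) = fun=> 0); first exact: module_hom_zero.
  by apply/funext => x; rewrite big_nil.
rewrite (_ : (fun _ => _) = fun x => g i x + \sum_(j <- r) g j x).
  exact: module_hom_add.
by apply/funext => x; rewrite big_cons.
Qed.

Lemma module_hom_iter N f k : module_hom N N f -> module_hom N N (iter k f).
Proof.
move=> fP; elim: k => [|k IHk]; first by split.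
exact: module_hom_comp IHk fP.
Qed.

Lemma module_hom_ext N N' f g : submodule M N ->
  (forall x, N x -> f x = g x) -> module_hom N N' f -> module_hom N N' g.
Proof.
move=> sN fg [fN fL fM]; split=> [x Nx|a x y Nx Ny|h x Mh Nx].
- by rewrite -fg//; apply: fN.
- by rewrite -!fg ?fL//; apply: submoduleZD.
- by rewrite -!fg ?fM//; apply: (submodule_act sN).
Qed.

Lemma module_isom_ext N N' f g : submodule M N ->
  (forall x, N x -> f x = g x) -> module_isom N N' f -> module_isom N N' g.
Proof.
move=> sN fg [fP f0 fS]; split; first exact: module_hom_ext fg fP.
- by move=> x Nx; rewrite -fg//; apply: f0.
- by move=> y /fS[x Nx <-]; exists x; rewrite ?fg.
Qed.

Lemma module_isom_comp N1 N2 N3 f g :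
  module_isom N1 N2 f -> module_isom N2 N3 g -> module_isom N1 N3 (g \o f).
Proof.
move=> [fP f0 fS] [gP g0 gS]; split; first exact: module_hom_comp gP.
- by move=> x Nx /= /g0; case: fP => fN _ _ e; apply: f0 => //; apply: e; apply: fN.
- by move=> z /gS[y /fS[x Nx <-] <-]; exists x.
Qed.

Lemma module_isom_inj N N' f : submodule M N -> module_isom N N' f ->
  forall x y, N x -> N y -> f x = f y -> x = y.
Proof.
move=> sN [fP f0 _] x y Nx Ny fxy; apply/eqP; rewrite -subr_eq0; apply/eqP.
by apply: f0; [apply: submoduleB|rewrite (module_homB sN fP)// fxy subrr].
Qed.

Lemma module_isom_inv N N' f : submodule M N -> submodule M N' -> module_isom N N' f ->
  exists2 g, module_isom N' N g & forall x, N x -> g (f x) = x.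
Proof.
move=> sN sN' fI; have [fP f0 fS] := fI; have [fN fL fM] := fP.
(* A chosen preimage in [N]; the default 0 occurs only outside [N']. *)
pose g y := xget 0 [set x | N x /\ f x = y].
have gP y : N' y -> N (g y) /\ f (g y) = y.
  by move=> /fS[x Nx fx]; apply: (@xgetPex _ 0 [set x | N x /\ f x = y]); exists x.
have gN y : N' y -> N (g y) by move/gP => [].
have gK y : N' y -> f (g y) = y by move/gP => [].
have finj := module_isom_inj sN fI.
have fK x : N x -> g (f x) = x.
  by move=> Nx; apply: finj => //; [apply/gN/fN|rewrite gK//; apply: fN].
exists g => //; split; first split=> [//|a x y Nx Ny|h x Mh Nx].
- apply: finj; [by apply: gN; apply: submoduleZD|by apply: submoduleZD => //; apply: gN|].
  by rewrite fL ?gK//; [apply: submoduleZD|exact: gN|exact: gN].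
- apply: finj; [by apply: gN; apply: (submodule_act sN')|by apply: (submodule_act sN) => //; apply: gN|].
  rewrite gK; last exact: (submodule_act sN').
  by rewrite (fM h) ?gK//; exact: gN.
- by move=> y N'y gy; rewrite -(gK y)// gy (module_hom0 sN fP).
- by move=> x Nx; exists (f x); [apply: fN|apply: fK].
Qed.

(** * Fitting's lemma *)

Variable len : set V -> nat.
Hypothesis lenP : strict_length len.

(** Kernels of iterates grow and images shrink. Once neither changes between [k] and [k + k], kernel
    and image of the [k]-th iterate are complementary. The condition [0 < k] rules out the trivial
    splitting given by the identity. *)
Lemma fitting N f : submodule M N -> module_hom N N f ->
  exists2 k, (0 < k)%N &
    N = [set x + y | x in [set x | N x /\ iter k f x = 0] & y in iter k f @` N] /\
    [set x | N x /\ iter k f x = 0] `&` (iter k f @` N) = [set 0].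
Proof.
move=> sN fP; pose R k := iter k f @` N; pose K k := [set x | N x /\ iter k f x = 0].
have itP k := module_hom_iter k fP.
have itN k x : N x -> N (iter k f x) by case: (itP k) => + _ _; apply.
have sR k : submodule M (R k) := submodule_image sN (itP k).
have sK k : submodule M (K k) := submodule_ker sN (itP k).
have RS k : R (k + k)%N `<=` R k.
  by move=> _ [x Nx <-]; exists (iter k f x); [apply: itN|rewrite iterD].
have KS k : K k `<=` K (k + k)%N.
  by move=> x [Nx e]; split=> //; rewrite iterD e (module_hom0 sN (itP k)).
have KN k : K k `<=` N by move=> x [].
(* Both summands, the length of the image and the colength of the kernel, can only drop from [k] to
   [k + k]; minimality of their sum therefore fixes each of them. *)
have [|k k0 kmin] := @exists_argmin _ (fun k => (0 < k)%N)
    (fun k => len (R k) + (len N - len (K k)))%N; first by exists 1%N.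
have [leR eR] := lenP (sR _) (sR k) (@RS k).
have [leK eK] := lenP (sK _) (sK _) (@KS k).
have [leKN _] := lenP (sK _) sN (@KN (k + k)%N).
have := kmin (k + k)%N; rewrite addn_gt0 k0 => /(_ isT) lek.
have {}eR : R (k + k)%N = R k by apply: eR; lia.
have {}eK : K k = K (k + k)%N by apply: eK; lia.
exists k => //; split; apply/seteqP; split.
(* Since [iter k f x] equals [iter (k + k) f y] for some [y], subtracting [iter k f y] from [x]
   leaves an element of the kernel. *)
- move=> x Nx; have Rx : R k (iter k f x) by exists x.
  move: Rx; rewrite -eR => -[y Ny]; rewrite iterD => fy.
  exists (x - iter k f y); last first.
    by exists (iter k f y); [exists y|rewrite subrK].
  split; first by apply: submoduleB => //; apply: itN.
  by rewrite (module_homB sN (itP k)) ?fy ?subrr//; apply: itN.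
- by move=> _ [x [Nx _] [_ [y Ny <-] <-]]; apply: submoduleD => //; apply: itN.
- move=> x [[_ fx] [y Ny exy]]; rewrite -exy -iterD in fx; rewrite -exy /=.
  by have : K (k + k)%N y by []; rewrite -eK => -[].
- move=> _ ->; split; last exact: (submodule0 (sR k)).
  exact: (submodule0 (sK k)).
Qed.

Lemma indecomposable_split N J K : indecomposable M N ->
  submodule M J -> submodule M K -> N = [set x + y | x in J & y in K] ->
  J `&` K = [set 0] -> J = [set 0] \/ K = [set 0].
Proof.
move=> [_ _ dN] sJ sK eN eI; apply: contrapT => no; apply: dN.
by exists J, K; split=> //; split=> e; apply: no; [left|right].
Qed.

(** One of the two Fitting summands vanishes: a zero image means nilpotency, a zero kernel means
    that [f] is injective with image [N]. *)
Lemma indecomposable_nilpotent_or_isom N f : indecomposable M N -> module_hom N N f ->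
  (exists k, forall x, N x -> iter k f x = 0) \/ module_isom N N f.
Proof.
move=> iN fP; have [sN _ _] := iN; have [[//|k] _ [eN eI]] := fitting sN fP.
have itP k := module_hom_iter k fP.
case: (indecomposable_split iN _ _ eN eI) => [||K0|R0].
- exact: submodule_ker sN (itP _).
- exact: submodule_image sN (itP _).
- right; split=> // [x Nx fx|y].
    suff : [set x | N x /\ iter k.+1 f x = 0] x by rewrite K0.
    by split=> //; rewrite iterSr fx (module_hom0 sN (itP k)).
  rewrite {1}eN K0 => -[_ -> [_ [x Nx <-] <-]]; exists (iter k f x); last by rewrite add0r.
  by case: (itP k) => + _ _; apply.
- by left; exists k.+1 => x Nx; have : (iter k.+1 f @` N) (iter k.+1 f x) by [exists x]; rewrite R0.
Qed.

Lemma indecomposable_inj_isom N f : indecomposable M N -> module_hom N N f ->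
  (forall x, N x -> f x = 0 -> x = 0) -> module_isom N N f.
Proof.
move=> iN fP f0; case: (indecomposable_nilpotent_or_isom iN fP) => // -[k nil].
have [sN N0 _] := iN; have [x Nx []] := submodule_neq0 sN N0.
elim: k {nil}(nil x Nx) => //= k IHk /f0 e; apply/IHk/e.
by case: (module_hom_iter k fP) => + _ _; apply.
Qed.

(** This is the locality of the endomorphism ring. With [h] inverse to the sum, [h \o f] and
    [h \o g] add up to the identity on [N], and it suffices that one of them is bijective. *)
Lemma indecomposable_add_isom N f g : indecomposable M N ->
  module_hom N N f -> module_hom N N g -> module_isom N N (fun x => f x + g x) ->
  module_isom N N f \/ module_isom N N g.
Proof.
move=> iN fP gP fgI; have [sN N0 _] := iN.
have [fN _ _] := fP; have [gN _ _] := gP.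
have [h hI hK] := module_isom_inv sN sN fgI; have [hP _ _] := hI.
(* On [N], [u] is the composite of [h \o u] with the isomorphism inverted by [h]. *)
have cancel_h u : module_hom N N u -> module_isom N N (h \o u) -> module_isom N N u.
  move=> uP huI; have [uN _ _] := uP.
  have huI2 := module_isom_comp huI fgI; apply: module_isom_ext huI2 => // x Nx /=.
  have [_ _ fgS] := fgI; have [y Ny <-] := fgS _ (uN _ Nx).
  by rewrite hK.
case: (indecomposable_nilpotent_or_isom iN (module_hom_comp fP hP)) => [[k nil]|]; last first.
  by left; apply: cancel_h.
right; apply: cancel_h => //; apply: indecomposable_inj_isom => //.
  exact: module_hom_comp hP.
(* If [h (g x) = 0] then [h (f x) = x], so [x] is fixed by all iterates of the nilpotent map
   [h \o f] and must be 0. *)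
move=> x Nx /= hgx; rewrite -(nil _ Nx); elim: k {nil} => //= k <-.
rewrite -{1}(hK _ Nx) (module_homD hP) ?hgx ?addr0//; [exact: fN|exact: gN].
Qed.

Lemma indecomposable_sum_isom N (I : Type) (r : seq I) (g : I -> V -> V) :
  indecomposable M N -> (forall i, module_hom N N (g i)) ->
  module_isom N N (fun x => \sum_(i <- r) g i x) -> exists i, module_isom N N (g i).
Proof.
move=> iN gP; have [sN N0 _] := iN; elim: r => [[_ inj _]|i r IHr gI].
  have [x Nx []] := submodule_neq0 sN N0.
  by apply: inj => //; rewrite big_nil.
have rP : module_hom N N (fun x => \sum_(j <- r) g j x) by apply: module_hom_big_sum.
case: (indecomposable_add_isom iN (gP i) rP); last exact: IHr.
- by apply: module_isom_ext gI => // x _; rewrite big_cons.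
- by exists i.
Qed.

(** * Direct sums *)

(** The default family [[ffun=> 0]] is never reached when [I] is a direct sum. *)
Definition dproj n (I : 'I_n -> set V) (i : 'I_n) (x : V) : V :=
  xget [ffun=> 0] [set v : {ffun 'I_n -> V} |
    (forall i, I i (v i)) /\ x = \sum_(i < n) v i] i.

Section Projections.
Variables (n : nat) (I : 'I_n -> set V).
Hypotheses (dI : direct_sum I) (sI : forall i, submodule M (I i)).

Lemma dprojP x : (forall i, I i (dproj I i x)) /\ x = \sum_(i < n) dproj I i x.
Proof.
have [v [vP _]] := dI x.
exact: (@xgetPex _ _ [set v : {ffun 'I_n -> V} |
    (forall i, I i (v i)) /\ x = \sum_(i < n) v i] (ex_intro _ v vP)).
Qed.

Lemma dproj_in i x : I i (dproj I i x).
Proof. by case: (dprojP x). Qed.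

Lemma dproj_sum x : \sum_(i < n) dproj I i x = x.
Proof. by case: (dprojP x). Qed.

Lemma dproj_uniq (v : 'I_n -> V) j :
  (forall i, I i (v i)) -> dproj I j (\sum_(i < n) v i) = v j.
Proof.
move=> vI; have [w [_ wP]] := dI (\sum_(i < n) v i).
set x := \sum_(i < n) v i in wP *.
have e1 : w = finfun v.
  by apply: wP; split=> [i|]; [rewrite ffunE|apply: eq_bigr => i _; rewrite ffunE].
have e2 : w = [ffun i => dproj I i x].
  apply: wP; split=> [i|]; first by rewrite ffunE; apply: dproj_in.
  by rewrite -[LHS]dproj_sum; apply: eq_bigr => i _; rewrite ffunE.
by move: e2; rewrite e1 => /ffunP/(_ j); rewrite !ffunE.
Qed.

Lemma dproj_hom i : module_hom [set: V] (I i) (dproj I i).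
Proof.
split=> [x _|a x y _ _|g x Mg _]; first exact: dproj_in.
- rewrite -{1}(dproj_sum x) -{1}(dproj_sum y) scaler_sumr -big_split /= dproj_uniq// => j.
  by apply: submoduleZD; rewrite //; apply: dproj_in.
- rewrite -{1}(dproj_sum x) act_sum// dproj_uniq// => j.
  by apply: (submodule_act (sI j)) => //; apply: dproj_in.
Qed.

Lemma dproj_other i j x : i != j -> I i x -> dproj I j x = 0.
Proof.
move=> ij Ix; pose v k := if k == i then x else 0.
have <- : \sum_(k < n) v k = x by rewrite -big_mkcond big_pred1_eq.
rewrite dproj_uniq /v ?[j == i]eq_sym ?(negbTE ij)// => k.
by case: eqP => [->//|_]; apply: submodule0.
Qed.

Lemma dproj_id i x : I i x -> dproj I i x = x.
Proof.
move=> Ix; rewrite -{2}(dproj_sum x) (bigD1 i)//= big1 ?addr0// => j ji.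
by apply: dproj_other Ix; rewrite eq_sym.
Qed.

End Projections.

Lemma direct_sum_intro n (I : 'I_n -> set V) : (forall i, submodule M (I i)) ->
  (forall x, exists2 v : 'I_n -> V, (forall i, I i (v i)) & x = \sum_(i < n) v i) ->
  (forall v : 'I_n -> V, (forall i, I i (v i)) -> \sum_(i < n) v i = 0 -> forall i, v i = 0) ->
  direct_sum I.
Proof.
move=> sI ex indep x; have [v vI ->] := ex x.
exists (finfun v); split=> [|w [wI e]].
  by split=> [i|]; [rewrite ffunE|apply: eq_bigr => i _; rewrite ffunE].
apply/ffunP => i; rewrite ffunE; apply/eqP; rewrite -subr_eq0; apply/eqP.
apply: (indep (fun i => v i - w i)) => [j|]; first exact: submoduleB.
by rewrite sumrB -e subrr.
Qed.

(** The kernel of the projection onto [K k] is the sum of the other [K i], and a submodule mapped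
    bijectively onto [K k] is a complement of that kernel. *)
Lemma direct_sum_exchange n (K : 'I_n -> set V) (k : 'I_n) J :
  direct_sum K -> (forall i, submodule M (K i)) -> submodule M J ->
  module_isom J (K k) (dproj K k) ->
  direct_sum (fun i => if i == k then J else K i).
Proof.
move=> dK sK sJ [_ p0 pS]; apply: direct_sum_intro => [i|x|v vP v0 i].
- by case: ifP.
- have [y Jy pyx] := pS _ (dproj_in dK k x).
  (* As [y] has the same component in [K k] as [x], the difference [x - y] lies in the sum of the
     other summands. *)
  exists (fun i => if i == k then y else dproj K i (x - y)).
    by move=> i; case: ifP => // _; apply: dproj_in.
  rewrite (bigD1 k)//= eqxx (eq_bigr (fun i => dproj K i (x - y))); last first.
    by move=> i /negbTE ->.
  have := dproj_sum dK (x - y); rewrite (bigD1 k)//=.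
  rewrite (module_homB submoduleT (dproj_hom dK sK k))// pyx subrr add0r => ->.
  by rewrite addrC subrK.
- have vK j : j != k -> K j (v j) by move=> jk; have := vP j; rewrite (negbTE jk).
  (* Projecting the relation onto [K k] kills every term but that of [v k]. *)
  have vk : v k = 0.
    apply: p0; first by have := vP k; rewrite eqxx.
    have := @module_hom_sum _ _ _ submoduleT (dproj_hom dK sK k) _ (index_enum 'I_n) v (fun=> I).
     rewrite v0 (module_hom0 submoduleT (dproj_hom dK sK k)) (bigD1 k)//=.
    rewrite big1 ?addr0// => j jk; exact: (dproj_other dK sK jk (vK _ jk)).
  have {}vK j : K j (v j).
    by have [->|/vK//] := eqVneq j k; rewrite vk; apply: submodule0.
  by rewrite -(dproj_uniq dK i vK) v0 (module_hom0 submoduleT (dproj_hom dK sK i)).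
Qed.

(** * The Krull-Schmidt theorem *)

(** Induction on the length: a decomposable [N] splits into two strictly shorter submodules, and the
    zero module is the empty sum. Spanning and independence are spelled out because [direct_sum]
    concerns the whole space only. *)
Lemma indecomposable_decomposition N : submodule M N ->
  exists (n : nat) (I : 'I_n -> set V),
    [/\ forall i, indecomposable M (I i), forall i, I i `<=` N,
        forall x, N x -> exists2 v : 'I_n -> V, (forall i, I i (v i)) & x = \sum_(i < n) v i
      & forall v : 'I_n -> V, (forall i, I i (v i)) -> \sum_(i < n) v i = 0 ->
          forall i, v i = 0].
Proof.
move: {2}(len N).+1 (ltnSn (len N)) => b; elim: b N => // b IHb N lenN sN.
case: (pselect (N = [set 0])) => [->|N0].
  exists 0%N, (fun _ => set0); split=> [[]//|[]//|x ->|v _ _ []//].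
  by exists (fun=> 0) => [[]//|]; rewrite big_ord0.
case: (pselect (decomposable M N)) => [|dN]; last first.
  exists 1%N, (fun _ => N); split=> [_|_ x|x Nx|v _ + i] //.
  - by exists (fun=> x) => //; rewrite big_ord1.
  - by rewrite big_ord1 (ord1 i).
case=> [J [K [[sJ sK] [J0 K0] eN JK]]].
have JN : J `<=` N.
  by move=> x Jx; rewrite eN; exists x => //; exists 0; [apply: submodule0|rewrite addr0].
have KN : K `<=` N.
  by move=> x Kx; rewrite eN; exists 0; [apply: submodule0|exists x; rewrite ?add0r].
have lenJ : (len J < b)%N.
  have [le e] := lenP sJ sN JN; rewrite -ltnS; apply: leq_trans lenN.
  rewrite ltnS ltn_neqAle le andbT; apply/eqP => /e eJ.
  by apply: K0; rewrite -JK eJ setIidr.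
have lenK : (len K < b)%N.
  have [le e] := lenP sK sN KN; rewrite -ltnS; apply: leq_trans lenN.
  rewrite ltnS ltn_neqAle le andbT; apply/eqP => /e eK.
  by apply: J0; rewrite -JK eK setIidl.
have [n1 [I1 [iI1 I1J ex1 in1]]] := IHb J lenJ sJ.
have [n2 [I2 [iI2 I2K ex2 in2]]] := IHb K lenK sK.
(* Concatenation of two families, polymorphic so as to serve for submodules and for vectors. *)
pose glue T (u1 : 'I_n1 -> T) (u2 : 'I_n2 -> T) (i : 'I_(n1 + n2)) :=
  match fintype.split i with inl i1 => u1 i1 | inr i2 => u2 i2 end.
have glue_l T u1 u2 i : @glue T u1 u2 (lshift n2 i) = u1 i.
  by rewrite /glue (unsplitK (inl _ i)).
have glue_r T u1 u2 i : @glue T u1 u2 (rshift n1 i) = u2 i.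
  by rewrite /glue (unsplitK (inr _ i)).
exists (n1 + n2)%N, (glue _ I1 I2); split=> [i|i|x|v vI v0 i].
- by rewrite /glue; case: fintype.split.
- by rewrite /glue; case: fintype.split => j; [apply: subset_trans JN|apply: subset_trans KN].
- rewrite {1}eN => -[y /ex1[v1 v1I ->] [z /ex2[v2 v2I ->] <-]].
  exists (glue _ v1 v2); first by move=> i; rewrite /glue; case: fintype.split.
  rewrite big_split_ord /=; congr (_ + _).
  + by apply: eq_bigr => i _; rewrite glue_l.
  + by apply: eq_bigr => i _; rewrite glue_r.
- have v1I j : I1 j (v (lshift n2 j)) by have := vI (lshift n2 j); rewrite glue_l.
  have v2I j : I2 j (v (rshift n1 j)) by have := vI (rshift n1 j); rewrite glue_r.
  rewrite big_split_ord /= in v0.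
  have J1 : J (\sum_(j < n1) v (lshift n2 j)).
    by apply: submodule_sum => // j _; apply: I1J.
  have K2 : K (\sum_(j < n2) v (rshift n1 j)).
    by apply: submodule_sum => // j _; apply: I2K.
  (* The partial sum in [J] is the opposite of the one in [K], hence lies in their zero
     intersection. *)
  have z1 : \sum_(j < n1) v (lshift n2 j) = 0.
    suff : (J `&` K) (\sum_(j < n1) v (lshift n2 j)) by rewrite JK.
    split=> //; move/eqP: v0; rewrite addr_eq0 => /eqP ->.
    exact: submoduleN.
  rewrite z1 add0r in v0.
  by case: (split_ordP i) => j ->; [apply: (in1 _ v1I z1)|apply: (in2 _ v2I v0)].
Qed.

Section Exchange.
Variables (n m : nat) (I : 'I_n -> set V) (J : 'I_m -> set V).
Hypotheses (iI : forall i, indecomposable M (I i)) (iJ : forall j, indecomposable M (J j)).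
Hypothesis dJ : direct_sum J.

(* [f] records which [I i] have already been exchanged, and for which [J j]. *)
Let exchanged (f : 'I_n -> option 'I_m) i := oapp J (I i) (f i).

(** Once [p \o dproj J j] is bijective on [I k], the module [J j] is the direct sum of the image of
    [I k] and the kernel of [p]. The image is nonzero, so indecomposability of [J j] makes the
    kernel vanish and both maps bijective. *)
Lemma exchange_step (f : 'I_n -> option 'I_m) k : f k = None ->
  direct_sum (exchanged f) ->
  exists j, [/\ forall i, f i <> Some j, module_isom (I k) (J j) (dproj J j)
    & direct_sum (exchanged (fun i => if i == k then Some j else f i))].
Proof.
move=> fk dK; have [sI I0 _] := iI k.
have sJ j : submodule M (J j) by case: (iJ j).
have sK i : submodule M (exchanged f i).
  by rewrite /exchanged; case: (f i) => [j|] //=; case: (iI i).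
have Kk : exchanged f k = I k by rewrite /exchanged fk.
pose p := dproj (exchanged f) k.
have pP N : module_hom N (I k) p.
  by rewrite -Kk; apply: module_hom_sub (dproj_hom dK sK k).
have qP N j : module_hom N (J j) (dproj J j) by apply: module_hom_sub (dproj_hom dJ sJ j).
have [|||j pqI] := @indecomposable_sum_isom (I k) _ (index_enum 'I_m)
    (fun j => p \o dproj J j) => //.
- by move=> j; apply: module_hom_comp (pP (J j)).
- apply: (@module_isom_ext _ _ idfun) => // [x Ix|].
    rewrite -[LHS](dproj_id dK sK (i := k)) ?Kk// -/p /=.
    by rewrite -[in LHS](dproj_sum dJ x) (module_hom_sum submoduleT (pP setT)).
  by split=> // y Iy; exists y.
have [_ pq0 pqS] := pqI.
have [x Ix x0] := submodule_neq0 sI I0.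
pose R := dproj J j @` I k; pose Z := [set y | J j y /\ p y = 0].
have sR : submodule M R := submodule_image sI (qP _ j).
have sZ : submodule M Z := submodule_ker (sJ j) (pP _).
have RJ : R `<=` J j by move=> _ [y _ <-]; apply: dproj_in.
have eJ : J j = [set y + z | y in R & z in Z].
  apply/seteqP; split=> [y Jy|_ [y /RJ Jy [z [Jz _] <-]]]; last exact: submoduleD.
  have [z Iz pqz] : exists2 z, I k z & (p \o dproj J j) z = p y.
    (* Surjectivity of the composite yields [z] in [I k] whose projection to [J j] has the same
       image under [p] as [y]; the two then differ by an element of [Z]. *)
    by apply: pqS; case: (pP (J j)) => + _ _; apply.
  exists (dproj J j z); first by exists z.
  exists (y - dproj J j z); last by rewrite addrC subrK.
  split; first by apply: submoduleB => //; apply: dproj_in.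
  by rewrite (module_homB submoduleT (pP setT))// -pqz subrr.
have RZ : R `&` Z = [set 0].
  apply/seteqP; split=> [_ [[y Iy <-] [_ /pq0]]|_ ->] /=; last first.
    by split; apply: submodule0.
  by move=> /(_ Iy) ->; apply: (module_hom0 submoduleT (qP setT j)).
have {RZ}Z0 : Z = [set 0].
  case: (indecomposable_split (iJ j) sR sZ eJ RZ) => // R0; case: x0.
  apply: pq0 => //=; have : R (dproj J j x) by exists x.
  by rewrite R0 => ->; apply: (module_hom0 submoduleT (pP setT)).
exists j; split.
(* A [J j] used before is a summand at an index other than [k], so [p] kills it, against injectivity
   of the composite on the nonzero [x]. *)
- move=> i fi; apply: x0; apply: pq0 => //=.
  apply: (dproj_other dK sK (i := i)); first by apply/eqP => e; rewrite e fk in fi.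
  by rewrite /exchanged fi; apply: dproj_in.
- split=> // [y Iy qy|y].
    by apply: pq0 => //=; rewrite qy (module_hom0 submoduleT (pP setT)).
  by rewrite eJ Z0 => -[z [u Iu <-] [_ -> <-]]; exists u; rewrite ?addr0.
- rewrite (_ : exchanged _ = fun i => if i == k then J j else exchanged f i); last first.
    by apply/funext => i; rewrite /exchanged; case: ifP.
  apply: direct_sum_exchange => //; rewrite Kk; split=> // [y Jy py|y Iy].
    by suff : Z y by rewrite Z0.
  by have [z Iz <-] := pqS y Iy; exists (dproj J j z) => //; apply: dproj_in.
Qed.

(** The summands are exchanged in the order of their indices, so that after [k] steps [f] is defined
    exactly below [k]. The isomorphisms obtained are projections of the fixed decomposition [J], so
    later steps do not affect them. *)
Theorem krull_schmidt_injection : direct_sum I ->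
  exists2 s : 'I_n -> 'I_m, injective s &
    forall i, module_isom (I i) (J (s i)) (dproj J (s i)).
Proof.
move=> dI.
suff main k : (k <= n)%N -> exists f : 'I_n -> option 'I_m,
    [/\ forall i, isSome (f i) = (i < k)%N,
        forall i i' j, f i = Some j -> f i' = Some j -> i = i',
        forall i j, f i = Some j -> module_isom (I i) (J j) (dproj J j)
      & direct_sum (exchanged f)].
  have [f [fS finj fI _]] := main n (leqnn n).
  have sP i : {j | f i = Some j}.
    by have := fS i; rewrite ltn_ord; case: (f i) => // j _; exists j.
  exists (fun i => sval (sP i)) => [i i' e|i]; last exact: fI (svalP (sP i)).
  by apply: (finj _ _ _ (svalP (sP i))); rewrite e; apply: (svalP (sP i')).
elim: k => [_|k IHk kn]; first by exists (fun=> None).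
have [f [fS finj fI fd]] := IHk (ltnW kn); pose k' := Ordinal kn.
have fk : f k' = None by have := fS k'; rewrite /= ltnn; case: (f k').
have [j [jnew jI jd]] := exchange_step fk fd.
exists (fun i => if i == k' then Some j else f i); split=> // [i|i i' j'|i j'].
- by rewrite ltnS leq_eqVlt -fS -[(i : nat) == k]/(i == k'); case: ifP.
- case: eqP => [->|_]; case: eqP => [->|_] //; last exact: finj.
  + by move=> -[<-] /jnew.
  + by move=> + [e]; rewrite -e => /jnew.
- by case: eqP => [-> [<-]//|_]; apply: fI.
Qed.

End Exchange.

End Submodules.

(** * Finite-dimensional modules *)

Section FiniteDimension.
Context {F : fieldType} {V : lmodType F}.
Variables (M : set (V -> V)) (n : nat) (phi : V -> 'rV[F]_n).
Hypotheses (phiL : linear phi) (phi_inj : injective phi).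

(** Among the matrices whose row space lies in the image of [N], one of maximal rank fills that
    image: a missing vector could be added to its row space, raising the rank. *)
Lemma submodule_rowspace (N : set V) : submodule M N ->
  exists A : 'M[F]_n, forall u : 'rV_n, (u <= A)%MS <-> exists2 x, N x & phi x = u.
Proof.
move=> sN.
have phi0 : phi 0 = 0.
  have := phiL 1 0 0; rewrite !scale1r addr0 => /esym/eqP.
  by rewrite -subr_eq0 addrK => /eqP.
pose P (A : 'M[F]_n) := forall u : 'rV_n, (u <= A)%MS -> exists2 x, N x & phi x = u.
(* Ranks are at most [n], so minimizing the corank maximizes the rank. *)
have [|A PA maxA] := @exists_argmin _ P (fun A => n - \rank A)%N.
  exists 0 => u; rewrite submx0 => /eqP ->.
  by exists 0; [apply: submodule0 sN|].
exists A => u; split=> [/PA//|[x Nx <-]].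
apply: contrapT => /negP xA.
have PAx : P (A + phi x)%MS.
  move=> _ /sub_addsmxP[[B c] ->] /=.
  have [y Ny ey] := PA _ (submxMl B A).
  exists (c 0 0 *: x + y); first exact: (submoduleZD sN).
  by rewrite phiL ey [X in _ = _ + X *m _]mx11_scalar mul_scalar_mx addrC.
have := maxA _ PAx; apply/negP; rewrite -ltnNge.
have /rank_ltmx : (A < A + phi x)%MS.
  by rewrite ltmxE addsmxSl /= addsmx_sub submx_refl.
have := rank_leq_row (A + phi x)%MS; lia.
Qed.

(** The length is the dimension, computed as a rank; nested row spaces of equal rank coincide, and
    injectivity of [phi] carries this back to the submodules. *)
Lemma strict_length_of_coordinates : exists len, strict_length M len.
Proof.
pose Q N (A : 'M[F]_n) := forall u : 'rV_n, (u <= A)%MS <-> exists2 x, N x & phi x = u.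
pose mx_of N := xget 0 (Q N : set 'M[F]_n).
have mxP N : submodule M N -> Q N (mx_of N).
  by move=> /submodule_rowspace; apply: (@xgetPex _ 0 (Q N)).
exists (fun N => \rank (mx_of N)) => N N' sN sN' NN'.
have [PN PN'] := (mxP _ sN, mxP _ sN').
have sub : (mx_of N <= mx_of N')%MS.
  apply/row_subP => i; apply/PN'.
  by have /PN[x /NN' N'x <-] := row_sub i (mx_of N); exists x.
split=> [|erank]; first exact: mxrankS.
apply/seteqP; split=> // x N'x.
have sub' : (mx_of N' <= mx_of N)%MS by have [_ <-] := mxrank_leqif_sup sub; apply/eqP.
have /PN[y Ny /phi_inj <- //] : (phi x <= mx_of N)%MS.
by apply: submx_trans sub'; apply/PN'; exists x.
Qed.

End FiniteDimension.

(** * The multiplication algebra *)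

Section MultiplicationAlgebra.
Context {F : fieldType} {A : lmodType F}.
Variable mul : {bilinear A -> A -> A}.

(** The linear maps form a subalgebra containing all generators, hence the smallest one. *)
Lemma mult_algebra_linear f : mult_algebra mul f -> linear f.
Proof.
apply: (_ : mult_algebra mul `<=` [set f | linear f])%classic.
apply: smallest_sub.
  split=> // [a g h gL hL b x y|g h gL hL b x y] /=.
  - by rewrite gL hL !scalerDr !scalerA addrACA [a * b]mulrC.
  - by rewrite hL gL.
by move=> g [x [->|->]] a y z; rewrite ?linearPr ?linearPl.
Qed.

Lemma mult_algebra_mull x : mult_algebra mul (mul x).
Proof. by apply: sub_gen_smallest; exists x; left. Qed.

Lemma mult_algebra_mulr x : mult_algebra mul (mul^~ x).
Proof. by apply: sub_gen_smallest; exists x; right. Qed.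

Lemma submodule_ideal I : submodule (mult_algebra mul) I -> ideal mul I.
Proof.
move=> sI; split=> [|x y Iy]; first by case: sI.
split; first exact: (submodule_act sI (mult_algebra_mull x)).
exact: (submodule_act sI (mult_algebra_mulr x)).
Qed.

(* Since the projection [pi] onto [J j] commutes with left and right
   multiplications, [pi (x y) = pi (pi (x y)) = pi (x pi(y)) = pi(x) pi(y)]. *)
Lemma dproj_alg_isomorphic n (I : set A) (J : 'I_n -> set A) j :
  direct_sum J -> (forall j, submodule (mult_algebra mul) (J j)) ->
  submodule (mult_algebra mul) I ->
  module_isom (mult_algebra mul) I (J j) (dproj J j) -> alg_isomorphic mul I (J j).
Proof.
move=> dJ sJ sI qI; have [[qJ qL _] _ qS] := qI.
have qM := dproj_hom mult_algebra_linear dJ sJ j.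
have [_ _ q_act] := qM.
exists (dproj J j); split=> // [|x y Ix Iy].
- split=> // x y /set_mem Ix /set_mem Iy.
  exact: (module_isom_inj sI qI).
- rewrite -[LHS](dproj_id dJ sJ (i := j)); last exact: dproj_in.
  rewrite (q_act _ y (mult_algebra_mull x))//.
  by rewrite (q_act _ x (mult_algebra_mulr (dproj J j y))).
Qed.

End MultiplicationAlgebra.

Theorem theorem2p2 (F : fieldType) (A : lmodType F)
    (mul : {bilinear A -> A -> A}) :
  (finite_dimensional A -> finite_length (mult_algebra mul)) /\
  (finite_length (mult_algebra mul) ->
    (exists (n : nat) (I : 'I_n -> set A),
       (forall i, ideal mul (I i) /\ indecomposable (mult_algebra mul) (I i)) /\
       direct_sum I) /\
    (forall (n m : nat) (I : 'I_n -> set A) (J : 'I_m -> set A),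
       (forall i, ideal mul (I i) /\ indecomposable (mult_algebra mul) (I i)) ->
       (forall j, ideal mul (J j) /\ indecomposable (mult_algebra mul) (J j)) ->
       direct_sum I -> direct_sum J ->
       exists (e : n = m) (sigma : {perm 'I_n}),
         forall i, alg_isomorphic mul (I i) (J (cast_ord e (sigma i))))).
Proof.
have Mlin := @mult_algebra_linear _ _ mul.
split=> [[n [[phi phiL phi_bij]]]|].
  have [len lenP] := strict_length_of_coordinates (mult_algebra mul) phiL (bij_inj phi_bij).
  exact: bounded_strict_length_finite_length lenP.
move=> /(finite_length_strict_length Mlin)[len lenP]; split.
  have [n [I [iI _ exI indI]]] :=
    indecomposable_decomposition lenP (submoduleT (mult_algebra mul)).
  have sI i : submodule (mult_algebra mul) (I i) by case: (iI i).
  exists n, I; split; first by move=> i; split=> //; apply: submodule_ideal.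
  by apply: (direct_sum_intro sI) => // x; apply: exI.
move=> n m I J iI iJ dI dJ.
have {}iI i : indecomposable (mult_algebra mul) (I i) by case: (iI i).
have {}iJ j : indecomposable (mult_algebra mul) (J j) by case: (iJ j).
have [s s_inj sP] := krull_schmidt_injection Mlin lenP iI iJ dJ dI.
have [t t_inj _] := krull_schmidt_injection Mlin lenP iJ iI dI dJ.
(* Injections between the index sets in both directions give equal cardinalities, after which [s] is
   an injective self-map of a finite set, hence a permutation. *)
have e : n = m.
  by apply/eqP; rewrite eqn_leq; have := leq_card s s_inj; have := leq_card t t_inj;
    rewrite !card_ord => -> ->.
subst m; exists erefl, (perm s_inj) => i; rewrite cast_ord_id permE.
by apply: dproj_alg_isomorphic (sP i) => // [j|]; [case: (iJ j)|case: (iI i)].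
Qed.
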